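(* Let $n\in\mathbb{N}$, $i\in\{1,\dots,n-1\}$, let $H$ be an $i$-dimensional linear subspace of $\mathbb{R}^n$, let $\mathcal{B}=\mathcal{K}^n$ or $\mathcal{B}=\mathcal{K}^n_n$, and let $\diamondsuit:\mathcal{B}\to\mathcal{B}_H$ be a symmetrization. Assume that there exists a strictly increasing set function $F:\mathcal{B}\to[0,\infty)$ such that $\diamondsuit$ is $F$-preserving. If $\diamondsuit$ is monotonic and invariant on $H$-symmetric spherical cylinders, then $\diamondsuit$ is projection invariant, i.e. $(\diamondsuit K)|H=K|H$ for all $K\in\mathcal{B}$.
   Context: $\mathcal{K}^n$ is the family of all nonempty compact convex subsets of $\mathbb{R}^n$, and $\mathcal{K}^n_n$ is the family of those with nonempty interior (convex bodies). For a linear subspace $H$, $A|H$ is the orthogonal projection of the set or point $A$ onto $H$, and $H^\perp$ is the orthogonal complement of $H$. A set is $H$-symmetric if it is invariant under the reflection in $H$, $x\mapsto 2(x|H)-x$. $\mathcal{B}_H$ is the family of all $H$-symmetric members of $\mathcal{B}$. A symmetrization is any map $\diamondsuit:\mathcal{B}\to\mathcal{B}_H$. $B_2^n$ is the closed Euclidean unit ball of $\mathbb{R}^n$ centred at the origin. $\diamondsuit$ is monotonic if $K,L\in\mathcal{B}$, $K\subseteq L$ imply $\diamondsuit K\subseteq\diamondsuit L$. A function $F:\mathcal{B}\to[0,\infty)$ is strictly increasing if $K,L\in\mathcal{B}$, $K\subsetneq L$ imply $F(K)<F(L)$. $\diamondsuit$ is $F$-preserving if $F(\diamondsuit K)=F(K)$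 for all $K\in\mathcal{B}$. An $H$-symmetric spherical cylinder is any set of the form $(r(B_2^n\cap H)+x)+s(B_2^n\cap H^\perp)$ with $r,s>0$, $x\in H$; $\diamondsuit$ is invariant on $H$-symmetric spherical cylinders if $\diamondsuit C=C$ for every such cylinder $C$. *)

(* Defs.v *)
From HB Require Import structures.
From mathcomp Require Import all_boot all_order all_algebra.
From mathcomp Require Import sesquilinear.
From mathcomp Require Import all_classical all_reals all_analysis.

Set Implicit Arguments.
Unset Strict Implicit.
Unset Printing Implicit Defensive.

Import Order.TTheory GRing.Theory Num.Theory.
Import numFieldNormedType.Exports.

Local Open Scope classical_set_scope.
Local Open Scope ring_scope.

Section EuclideanSpace.
Context {R : realType} {n : nat}.
Implicit Types (u v x : 'rV[R]_n) (H : {vspace 'rV[R]_n}).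
Implicit Types (A K : set 'rV[R]_n).

Definition dotp u v : R := \sum_(j < n) u 0 j * v 0 j.

Fact dotpC u v : dotp u v = dotp v u.
Proof. by apply: eq_bigr => j _; rewrite mulrC. Qed.

Fact dotp_linearl v : GRing.linear_for *%R (dotp ^~ v).
Proof.
move=> a u w; rewrite /dotp mulr_sumr -big_split; apply: eq_bigr => j _ /=.
by rewrite !mxE mulrDl mulrA.
Qed.

Fact dotp_linearr u : GRing.linear_for (idfun \; *%R) (dotp u).
Proof. by move=> a v w; rewrite dotpC dotp_linearl !(dotpC u). Qed.

HB.instance Definition _ := bilinear_isBilinear.Build R _ _ _ _ _ dotp
  (dotp_linearl, dotp_linearr).

Fact dotp_hermitian u v : dotp u v = (-1) ^+ false * idfun (dotp v u).
Proof. by rewrite expr0 mul1r dotpC. Qed.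

HB.instance Definition _ :=
  isHermitianSesquilinear.Build _ _ _ _ dotp dotp_hermitian.

Fact dotp_gt0 u : u != 0 -> 0 < dotp u u.
Proof.
move=> u0; rewrite lt_def sumr_ge0 ?andbT; last by move=> j _; rewrite -expr2 sqr_ge0.
apply: contra u0; rewrite psumr_eq0 => [/allP u0|j _]; last by rewrite -expr2 sqr_ge0.
apply/eqP/rowP => j; rewrite mxE; apply/eqP.
by have := u0 j (mem_index_enum _); rewrite mulf_eq0 orbb.
Qed.

HB.instance Definition _ := isDotProduct.Build _ _ dotp dotp_gt0.

(* [`|x|] on ['rV[R]_n] is the sup norm (it induces the same topology), hence
   the Euclidean norm has to be introduced separately. *)
Definition enorm x : R := Num.sqrt (dotp x x).

Definition eball : set 'rV[R]_n := [set x | enorm x <= 1].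

Definition orthc H : {vspace 'rV[R]_n} := orthov dotp H.

Definition orth_proj H : 'End('rV[R]_n) := daddv_pi H (orthc H).

(* [daddv_pi] is a projection only if its two arguments are complementary;
   the next two facts show that they are here. *)
Fact cap_orthc H : (H :&: orthc H = 0)%VS.
Proof.
apply/eqP; rewrite -subv0; apply/subvP => x /memv_capP[xH /mem_orthovP/(_ _ xH) xx].
by rewrite memv0; apply: contra_eqT xx => /dotp_gt0; rewrite lt_def => /andP[].
Qed.

Fact add_orthc H : (H + orthc H = fullv)%VS.
Proof.
apply/eqP; rewrite -dimv_leqif_eq ?subvf// eqn_leq dimvS ?subvf//=.
rewrite dimv_disjoint_sum ?cap_orthc//.
pose f u : 'rV[R]_(\dim H) := \row_i dotp u (vbasis H)`_i.
have lf : linear f by move=> a u v; apply/rowP => i; rewrite !mxE; exact: dotp_linearl.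
pose fL : {linear 'rV[R]_n -> 'rV[R]_(\dim H)} :=
  HB.pack f (GRing.isLinear.Build _ _ _ _ f lf).
have kf : (lker (linfun fL) <= orthc H)%VS.
  apply/subvP => u; rewrite memv_ker lfunE /= => /eqP/rowP fu.
  apply/mem_orthovP => v /coord_vbasis ->; rewrite linear_sumr big1// => i _.
  by have := fu i; rewrite !mxE linearZr /= => ->; rewrite mulr0.
rewrite -(limg_ker_dim (linfun fL) fullv) capfv addnC leq_add ?dimvS//.
by apply: leq_trans (dimvS (subvf _)) _; rewrite dimvf /dim /= mul1n.
Qed.

Fact orth_projP H x : orth_proj H x \in H /\ x - orth_proj H x \in orthc H.
Proof.
split; first exact: memv_pi.
have xf : x \in (H + orthc H)%VS by rewrite add_orthc memvf.
rewrite -{1}(daddv_pi_add (cap_orthc H) xf) addrC addKr; exact: memv_pi.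
Qed.

Definition reflection H x : 'rV[R]_n := 2 *: orth_proj H x - x.

Definition H_symmetric H A : Prop := reflection H @` A = A.

Definition spherical_cylinder H (r s : R) x : set 'rV[R]_n :=
  [set (r *: u + x) + s *: v | u in eball `&` [set` H]
                             & v in eball `&` [set` orthc H]].

Definition convex_compacts : set (set 'rV[R]_n) :=
  [set K | [/\ K !=set0, compact K & convex_set (K : set (convex_lmodType 'rV[R]_n))]].

Definition convex_bodies : set (set 'rV[R]_n) :=
  [set K | convex_compacts K /\ K° !=set0].

Definition symmetric_members H (B : set (set 'rV[R]_n)) : set (set 'rV[R]_n) :=
  [set K | B K /\ H_symmetric H K].

Section SetMaps.
Variables (B : set (set 'rV[R]_n)) (D : set 'rV[R]_n -> set 'rV[R]_n).

Definition monotonic : Prop :=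
  forall K L, B K -> B L -> K `<=` L -> D K `<=` D L.

Definition strictly_increasing (F : set 'rV[R]_n -> R) : Prop :=
  forall K L, B K -> B L -> K `<` L -> F K < F L.

Definition preserving (F : set 'rV[R]_n -> R) : Prop :=
  forall K, B K -> F (D K) = F K.

Definition cylinder_invariant H : Prop :=
  forall (r s : R) x, 0 < r -> 0 < s -> x \in H ->
    D (spherical_cylinder H r s x) = spherical_cylinder H r s x.

Definition projection_invariant H : Prop :=
  forall K, B K -> orth_proj H @` D K = orth_proj H @` K.

End SetMaps.
End EuclideanSpace.

Arguments convex_compacts : clear implicits.
Arguments convex_bodies : clear implicits.

(* Main.v *)
Require Import Defs.
From mathcomp Require Import all_boot all_order all_algebra.
From mathcomp Require Import sesquilinear ring lra.
From mathcomp Require Import all_classical all_reals all_analysis.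

Import Order.TTheory GRing.Theory Num.Theory.
Import numFieldNormedType.Exports.

Local Open Scope classical_set_scope.
Local Open Scope ring_scope.

(** Write [P] for the orthogonal projection onto [H].

    The inclusion [P (D K) <= P K] is obtained from cylinders. A compact convex
    subset of [H] is an intersection of balls of [H]: a point [p] outside it is
    strictly separated from it by a hyperplane, hence by a ball with a far away
    centre ([ball_separation]). Over a ball containing [P K] there is a
    spherical cylinder [C] containing [K], as [K] is bounded; monotonicity and
    invariance give that [D K] is contained in [D C = C], so [P (D K)] is
    contained in the same ball ([proj_sub_of_cylinders]).

    This inclusion, applied to small sets, yields its own converse. Given [q]
    in [K], the homothetic copy [q + t (K - q)], for small [t > 0], lies in [K]
    and has a projection of size O(t) around [P q]. Its image under [D] is
    nonempty, lies in [D K] by monotonicity, and projects within O(t) of [P q]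
    by the first inclusion. Hence [P q] is in the closure of the compact set
    [P (D K)] ([proj_sub_of_proj_contracting]). Homothetic copies are used
    instead of points so that the argument stays inside the class of convex
    bodies. *)

(** * The squared Euclidean norm *)

Local Notation sqn x := (dotp x x).
Local Notation barycenter t x y := (t *: x + (1 - t) *: y).

Lemma sqn_ge0 {R : realType} {n : nat} (x : 'rV[R]_n) : 0 <= sqn x.
Proof. by apply: sumr_ge0 => j _; rewrite -expr2 sqr_ge0. Qed.

Lemma dotpZl {R : realType} {n : nat} (a : R) (x y : 'rV[R]_n) :
  dotp (a *: x) y = a * dotp x y.
Proof. exact: linearZl_LR. Qed.

Lemma dotpZr {R : realType} {n : nat} (a : R) (x y : 'rV[R]_n) :
  dotp x (a *: y) = a * dotp x y.
Proof. exact: linearZr. Qed.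

Lemma sqnZ {R : realType} {n : nat} (a : R) (x : 'rV[R]_n) :
  sqn (a *: x) = a ^+ 2 * sqn x.
Proof. by rewrite dotpZl dotpZr mulrA expr2. Qed.

Lemma sqnD {R : realType} {n : nat} (x y : 'rV[R]_n) :
  sqn (x + y) = sqn x + 2 * dotp x y + sqn y.
Proof. by rewrite linearDl !linearDr /= (dotpC y x); ring. Qed.

Lemma sqnB {R : realType} {n : nat} (x y : 'rV[R]_n) :
  sqn (x - y) = sqn x - 2 * dotp x y + sqn y.
Proof. by rewrite -scaleN1r sqnD sqnZ dotpZr; ring. Qed.

Lemma sqn_barycenter {R : realType} {n : nat} (t : R) (x y : 'rV[R]_n) :
  sqn (barycenter t x y)
  = t * sqn x + (1 - t) * sqn y - t * (1 - t) * sqn (x - y).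
Proof. by rewrite sqnB sqnD !sqnZ dotpZl dotpZr; ring. Qed.

Lemma enorm_le {R : realType} {n : nat} (r : R) (x : 'rV[R]_n) :
  0 <= r -> (enorm x <= r) = (sqn x <= r ^+ 2).
Proof.
by move=> r0; rewrite /enorm -[in LHS](ger0_norm r0) -sqrtr_sqr ler_sqrt ?sqr_ge0.
Qed.

Lemma sqn_continuous {R : realType} {n : nat} :
  continuous (fun x : 'rV[R]_n => sqn x).
Proof.
apply: continuous_big => [|j _ x]; first exact: add_continuous.
by apply: (@cvgM R _ (nbhs x) _ _ _ (x 0 j) (x 0 j)); exact: coord_continuous.
Qed.

Lemma continuous_sqn {R : realType} {n : nat} {T : topologicalType}
    (f : T -> 'rV[R]_n) : continuous f -> continuous (fun x => sqn (f x)).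
Proof.
move=> cf x; apply: (@continuous_comp _ _ _ f (fun z => sqn z)).
  exact: cf.
exact: sqn_continuous.
Qed.

(** Boundedness refers to the sup norm, while cylinders are described with the
    Euclidean one. *)
Lemma norm_le_enorm {R : realType} {n : nat} (x : 'rV[R]_n) : `|x| <= enorm x.
Proof.
rewrite [leLHS]/Num.norm /= mx_normrE; apply: bigmax_le; first exact: sqrtr_ge0.
move=> [i j] _ /=; rewrite ord1 -sqrtr_sqr ler_sqrt ?sqn_ge0//.
rewrite /dotp (bigD1 j)//= expr2 lerDl.
by apply: sumr_ge0 => k _; rewrite -expr2 sqr_ge0.
Qed.

(** * Continuous affine maps *)

Lemma rV_linear_continuous {R : realType} {m n : nat}
  (f : {linear 'rV[R]_m -> 'rV[R]_n}) : continuous f.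
Proof.
have -> : (f : _ -> _) = fun x => \sum_(j < m) x 0 j *: f (delta_mx 0 j).
  apply/funext => x; rewrite {1}(row_sum_delta x) linear_sum.
  by apply: eq_bigr => j _; rewrite linearZ.
apply: continuous_big => [|j _ x]; first exact: add_continuous.
apply: (@cvgZr_tmp R _ _ (nbhs x) _ _ (x 0 j)).
exact: coord_continuous.
Qed.

Definition continuous_affine {R : realType} {m n : nat}
    (f : 'rV[R]_m -> 'rV[R]_n) : Prop :=
  continuous f /\ forall t x y, f (barycenter t x y) = barycenter t (f x) (f y).

Lemma continuous_affine_linear {R : realType} {m n : nat}
    (f : {linear 'rV[R]_m -> 'rV[R]_n}) : continuous_affine f.
Proof.
by split=> [|t x y]; [exact: rV_linear_continuous | rewrite linearD !linearZ /=].
Qed.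

Lemma continuous_affineD {R : realType} {m n : nat}
    (f g : 'rV[R]_m -> 'rV[R]_n) :
  continuous_affine f -> continuous_affine g -> continuous_affine (f \+ g).
Proof.
move=> [cf af] [cg ag]; split=> [x|t x y].
  by apply: continuousD; [exact: cf|exact: cg].
by rewrite /= af ag !scalerDr addrACA.
Qed.

Lemma continuous_affine_cst {R : realType} {m n : nat} (c : 'rV[R]_n) :
  continuous_affine (fun _ : 'rV[R]_m => c).
Proof.
split=> [|t x y]; first exact: cst_continuous.
by rewrite -scalerDl addrC subrK scale1r.
Qed.

Lemma continuous_affine_subr {R : realType} {n : nat} (c : 'rV[R]_n) :
  continuous_affine (fun x => x - c).
Proof.
apply: continuous_affineD; last exact: continuous_affine_cst.
exact: (continuous_affine_linear idfun).
Qed.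

Lemma convex_setP {R : realType} {n : nat} (A : set 'rV[R]_n) :
  convex_set (A : set (convex_lmodType 'rV[R]_n)) <->
  (forall t x y, 0 <= t <= 1 -> A x -> A y -> A (barycenter t x y)).
Proof.
split=> [cA t x y /andP[t0 t1] Ax Ay|cA x y t /set_mem Ax /set_mem Ay].
  have := cA x y (Itv01 t0 t1) (mem_set Ax) (mem_set Ay).
  by move/set_mem.
by apply/mem_set/cA => //; rewrite ge0 le1.
Qed.

Lemma convex_compacts_image {R : realType} {m n : nat}
    (f : 'rV[R]_m -> 'rV[R]_n) (K : set 'rV[R]_m) :
  continuous_affine f -> convex_compacts R m K -> convex_compacts R n (f @` K).
Proof.
move=> [cf af] [K0 cK /convex_setP vK]; split; first exact: image_nonempty.
- by apply: continuous_compact => //; exact: continuous_subspaceT.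
- apply/convex_setP => t _ _ t01 [x Kx <-] [y Ky <-].
  by exists (barycenter t x y); [exact: vK | exact: af].
Qed.

(** * Sublevel sets of the squared norm of an affine map *)

Lemma sqn_sublevel_convex {R : realType} {m n : nat}
    (f : 'rV[R]_m -> 'rV[R]_n) (a : R) (t : R) (x y : 'rV[R]_m) :
  continuous_affine f -> 0 <= t <= 1 -> sqn (f x) <= a -> sqn (f y) <= a ->
  sqn (f (barycenter t x y)) <= a.
Proof.
move=> [_ af] /andP[t0 t1] fx fy; rewrite af sqn_barycenter.
have td : 0 <= t * (1 - t) * sqn (f x - f y).
  by rewrite !mulr_ge0 ?sqn_ge0 ?subr_ge0.
have tx : t * sqn (f x) <= t * a by rewrite ler_wpM2l.
have ty : (1 - t) * sqn (f y) <= (1 - t) * a by rewrite ler_wpM2l ?subr_ge0.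
lra.
Qed.

Lemma sqn_sublevel_closed {R : realType} {m n : nat}
    (f : 'rV[R]_m -> 'rV[R]_n) (a : R) :
  continuous_affine f -> closed [set x | sqn (f x) <= a].
Proof.
move=> [cf _]; apply: (@preimage_closed _ _ (fun x => sqn (f x)) [set u | u <= a]).
  by move=> x _; exact: continuous_sqn.
exact: closed_le.
Qed.

Lemma sqn_sublevel_open {R : realType} {m n : nat}
    (f : 'rV[R]_m -> 'rV[R]_n) (a : R) :
  continuous_affine f -> open [set x | sqn (f x) < a].
Proof.
move=> [cf _]; apply: (@open_comp _ _ (fun x => sqn (f x)) [set u | u < a]).
  by move=> x _; exact: continuous_sqn.
exact: open_lt.
Qed.

Lemma sqn_compact_bounded {R : realType} {m n : nat}
    (f : 'rV[R]_m -> 'rV[R]_n) (K : set 'rV[R]_m) :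
  continuous_affine f -> convex_compacts R m K ->
  exists2 M, 0 < M & forall x, K x -> sqn (f x) <= M.
Proof.
move=> [cf _] [K0 cK _].
have cs : {within K, continuous (fun x => sqn (f x))}.
  by apply: continuous_subspaceT; exact: continuous_sqn.
have [c /set_mem Kc cmax] := compact_EVT_max K0 cK cs.
exists (sqn (f c) + 1) => [|x Kx]; first by rewrite ltr_wpDl ?sqn_ge0.
by rewrite (le_trans (cmax _ (mem_set Kx)))// lerDl.
Qed.

(** * Separation of a point from a convex compact set by a ball *)

(** Let [q] be the point of [C] nearest to [p] and [w := p - q]. Then [C] lies
    in the half-space [dotp (y - q) w <= 0]. As [C] is bounded, it is therefore
    contained, for [t] large, in a ball centred at [q - t *: w] whose boundary
    crosses the segment between [q] and [p]. The centre lies on the line through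
    [p] and [q], hence in [H]. *)
Lemma ball_separation {R : realType} {n : nat} (H : {vspace 'rV[R]_n})
    (C : set 'rV[R]_n) (p : 'rV[R]_n) :
  convex_compacts R n C -> C `<=` [set` H] -> p \in H -> ~ C p ->
  exists x r, [/\ x \in H, 0 < r, forall y, C y -> sqn (y - x) <= r ^+ 2
    & r ^+ 2 < sqn (p - x)].
Proof.
move=> CC CH pH Cp.
have [C0 cC /convex_setP vC] := CC.
have cp : {within C, continuous (fun y => sqn (y - p))}.
  by apply/continuous_subspaceT/continuous_sqn; exact: (continuous_affine_subr p).1.
have [q /set_mem Cq qmin] := compact_EVT_min C0 cC cp.
have [w pE] : exists w, p = q + w by exists (p - q); rewrite addrC subrK.
have w0 : 0 < sqn w.
  by apply: dotp_gt0; apply: contra_notN Cp => /eqP w0; rewrite pE w0 addr0.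
(* Otherwise a short step from [q] towards [y] would come closer to [p]; the
   step length [l] below is chosen so that [l * sqn (y - q) < dotp (y - q) w]. *)
have obtuse y : C y -> dotp (y - q) w <= 0.
  move=> Cy; rewrite leNgt; apply/negP => a0.
  set a := dotp _ _ in a0; set b := sqn (y - q).
  have b0 : 0 <= b by exact: sqn_ge0.
  pose l := a / (a + b + 1).
  have d0 : 0 < a + b + 1 by lra.
  have lE : l * (a + b + 1) = a by rewrite /l divfK// gt_eqF.
  have l0 : 0 < l by rewrite divr_gt0.
  have l01 : 0 <= l <= 1 by rewrite (ltW l0) /l ler_pdivrMr// mul1r; lra.
  have := qmin _ (mem_set (vC _ _ _ l01 Cy Cq)).
  have -> : sqn (q - p) = sqn w.
    by rewrite pE opprD addNKr -scaleN1r sqnZ sqrrN expr1n mul1r.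
  have -> : barycenter l y q - p = l *: (y - q) - w.
    by apply/rowP => j; rewrite pE !mxE; ring.
  rewrite sqnB sqnZ dotpZl -/a -/b.
  have la : 0 < l * a by rewrite mulr_gt0.
  have lb : l * b < a by move: lE; rewrite !mulrDr mulr1; lra.
  have : l * (l * b) < l * a by rewrite ltr_pM2l.
  by lra.
have [M M0 hM] : exists2 M, 0 < M & forall x, C x -> sqn (x - q) <= M.
  by apply: sqn_compact_bounded => //; exact: continuous_affine_subr.
(* For [y] in [C] the squared distance to the centre is at most
   [M + t ^+ 2 * sqn w], and for [p] it is [(1 + t) ^+ 2 * sqn w]; with this [t]
   the squared radius [t ^+ 2 * sqn w + 2 * M] lies between the two. *)
pose t := M / sqn w.
have t0 : 0 < t by rewrite divr_gt0.
have tM : t * sqn w = M by rewrite /t divfK// gt_eqF.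
have r0 : 0 < t ^+ 2 * sqn w + 2 * M.
  by apply: addr_gt0; apply: mulr_gt0 => //; exact: exprn_gt0.
exists (q - t *: w), (Num.sqrt (t ^+ 2 * sqn w + 2 * M)).
have wH : w \in H.
  by rewrite -(addKr q w) -pE addrC rpredB//; exact: CH.
split=> [||y Cy|].
- by apply: memvB; [exact: CH|exact: memvZ].
- by rewrite sqrtr_gt0.
- rewrite sqr_sqrtr ?ltW//.
  have -> : y - (q - t *: w) = (y - q) + t *: w by rewrite opprB addrCA addrC.
  rewrite sqnD sqnZ dotpZr.
  have := obtuse _ Cy; have := hM _ Cy.
  by nra.
- rewrite sqr_sqrtr ?ltW//.
  have -> : p - (q - t *: w) = (1 + t) *: w.
    by apply/rowP => j; rewrite pE !mxE; ring.
  rewrite sqnZ; nra.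
Qed.

(** * Spherical cylinders *)

Lemma orth_proj_id {R : realType} {n : nat} {H : {vspace 'rV[R]_n}} {x} :
  x \in H -> orth_proj H x = x.
Proof. exact/daddv_pi_id/cap_orthc. Qed.

Lemma orth_proj_orthc {R : realType} {n : nat} {H : {vspace 'rV[R]_n}} {x} :
  x \in orthc H -> orth_proj H x = 0.
Proof.
move=> xo; have [Px Qx] := orth_projP H x.
apply/eqP; rewrite -memv0 -(cap_orthc H) memv_cap Px /=.
by rewrite -[X in X \in _](subKr x) rpredB.
Qed.

(** This turns a cylinder into an intersection of two sublevel sets of the
    squared norm of affine maps, from which convexity, closedness and the
    interior can be read off. *)
Lemma spherical_cylinderE {R : realType} {n : nat} (H : {vspace 'rV[R]_n})
    (r s : R) (x : 'rV[R]_n) : 0 < r -> 0 < s -> x \in H ->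
  spherical_cylinder H r s x =
  [set y | sqn (orth_proj H y - x) <= r ^+ 2] `&`
  [set y | sqn (y - orth_proj H y) <= s ^+ 2].
Proof.
move=> r0 s0 xH; apply/seteqP; split=> [_ [u [u1 uH] [v [v1 vH] <-]]|y [] /= yr ys].
  have Py : orth_proj H (r *: u + x + s *: v) = r *: u + x.
    rewrite linearD /= (orth_proj_orthc (memvZ s vH)) addr0 orth_proj_id//.
    by apply: memvD => //; exact: memvZ.
  rewrite /setI /= Py addrK (addrC (_ + x)) addrK !sqnZ.
  move: u1 v1; rewrite /eball /= !enorm_le// expr1n => u1 v1.
  by split; rewrite -[leRHS]mulr1 ler_pM2l ?exprn_gt0.
have [PH QH] := orth_projP H y.
exists (r^-1 *: (orth_proj H y - x)).
  split; last by rewrite /= rpredZ ?rpredB.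
  rewrite /eball /= enorm_le// sqnZ exprVn expr1n.
  by rewrite mulrC ler_pdivrMr ?exprn_gt0// mul1r.
exists (s^-1 *: (y - orth_proj H y)).
  split; last by rewrite /= rpredZ.
  rewrite /eball /= enorm_le// sqnZ exprVn expr1n.
  by rewrite mulrC ler_pdivrMr ?exprn_gt0// mul1r.
by rewrite !scalerA !divff ?gt_eqF// !scale1r subrK addrC subrK.
Qed.

Lemma continuous_affine_proj_sub {R : realType} {n : nat}
    (H : {vspace 'rV[R]_n}) (x : 'rV[R]_n) :
  continuous_affine (fun y => orth_proj H y - x).
Proof.
by apply: continuous_affineD; [exact: continuous_affine_linear |
  exact: continuous_affine_cst].
Qed.

Lemma continuous_affine_sub_proj {R : realType} {n : nat}
    (H : {vspace 'rV[R]_n}) : continuous_affine (fun y => y - orth_proj H y).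
Proof.
apply: continuous_affineD; first exact: (continuous_affine_linear idfun).
exact: (continuous_affine_linear (GRing.opp \o orth_proj H)).
Qed.

Lemma spherical_cylinder_body {R : realType} {n : nat} (H : {vspace 'rV[R]_n})
    (r s : R) (x : 'rV[R]_n) : 0 < r -> 0 < s -> x \in H ->
  convex_bodies R n (spherical_cylinder H r s x).
Proof.
move=> r0 s0 xH; rewrite spherical_cylinderE//.
have aP := continuous_affine_proj_sub H x; have aQ := continuous_affine_sub_proj H.
set A := [set y | _]; set B := [set y | _].
have intx : (A `&` B)° x.
  pose U := [set y | sqn (orth_proj H y - x) < r ^+ 2] `&`
            [set y | sqn (y - orth_proj H y) < s ^+ 2].
  have oU : open U by apply: openI; exact: sqn_sublevel_open.
  have UAB : U `<=` A `&` B by move=> y [] /ltW ? /ltW ?.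
  have /(_ x) := interiorS UAB; rewrite (interior_id U).1//; apply.
  have z : sqn (0 : 'rV[R]_n) = 0 by rewrite -(scale0r 0) sqnZ expr0n mul0r.
  by split; rewrite /= orth_proj_id// subrr z exprn_gt0.
split; last by exists x.
split; first by exists x; exact: interior_subset.
- apply: bounded_closed_compact; last by apply: closedI; exact: sqn_sublevel_closed.
  exists (`|x| + r + s); split=> [|M Mgt y [yA yB]]; first exact: num_real.
  apply: le_trans (ltW Mgt).
  have -> : y = x + (orth_proj H y - x) + (y - orth_proj H y).
    by rewrite [x + _]addrC subrK addrC subrK.
  rewrite (le_trans (ler_normD _ _))// lerD//.
    rewrite (le_trans (ler_normD _ _))// lerD//.
    by rewrite (le_trans (norm_le_enorm _))// enorm_le// ltW.
  by rewrite (le_trans (norm_le_enorm _))// enorm_le// ltW.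
- apply/convex_setP => t y z t01 [yA yB] [zA zB].
  split; first exact: (sqn_sublevel_convex _ _ _ _ _ aP).
  exact: (sqn_sublevel_convex _ _ _ _ _ aQ).
Qed.

(** * Comparison of projections *)

(** The height of a cylinder over a ball containing the projection of [K] can
    be taken as large as needed to contain [K], so that cylinders see every ball
    of [H] containing the projection; these balls intersect in it. *)
Lemma proj_sub_of_cylinders {R : realType} {n : nat} (H : {vspace 'rV[R]_n})
    (K L : set 'rV[R]_n) : convex_compacts R n K ->
  (forall r s x, 0 < r -> 0 < s -> x \in H ->
    K `<=` spherical_cylinder H r s x -> L `<=` spherical_cylinder H r s x) ->
  orth_proj H @` L `<=` orth_proj H @` K.
Proof.
move=> KC KL _ [z Lz <-]; apply: contrapT => nPz.
have PC := convex_compacts_image _ _ (continuous_affine_linear (orth_proj H)) KC.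
have PH : orth_proj H @` K `<=` [set` H].
  by move=> _ [y _ <-]; exact: (orth_projP H y).1.
have [x [r [xH r0 Kr rz]]] := ball_separation H _ _ PC PH (orth_projP H z).1 nPz.
have [M M0 hM] := sqn_compact_bounded _ _ (continuous_affine_sub_proj H) KC.
have s0 : 0 < Num.sqrt M by rewrite sqrtr_gt0.
have KCyl : K `<=` spherical_cylinder H r (Num.sqrt M) x.
  rewrite spherical_cylinderE// => y Ky; split; first by apply: Kr; exists y.
  by rewrite /= sqr_sqrtr ?(ltW M0)//; exact: hM.
have := KL _ _ _ r0 s0 xH KCyl _ Lz.
by rewrite spherical_cylinderE// => -[/= /le_lt_trans/(_ rz)]; rewrite ltxx.
Qed.

(** * Shrinking towards a point *)

Definition homothety {R : realType} {n : nat} (q : 'rV[R]_n) (t : R) (z : 'rV[R]_n) :=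
  barycenter t z q.

Lemma continuous_affine_homothety {R : realType} {n : nat} (q : 'rV[R]_n) (t : R) :
  continuous_affine (homothety q t).
Proof.
apply: continuous_affineD; last exact: continuous_affine_cst.
exact: (continuous_affine_linear ( *:%R t)).
Qed.

Lemma homothety_body {R : realType} {n : nat} (q : 'rV[R]_n) (t : R)
    (K : set 'rV[R]_n) : t != 0 ->
  convex_bodies R n K -> convex_bodies R n (homothety q t @` K).
Proof.
move=> t0 [KC [x intx]]; split.
  by apply: convex_compacts_image => //; exact: continuous_affine_homothety.
have hK : cancel (homothety q t^-1) (homothety q t).
  by move=> z; apply/rowP => j; rewrite !mxE; field.
have hK' : cancel (homothety q t) (homothety q t^-1).
  by move=> z; apply/rowP => j; rewrite !mxE; field.
have oV : open (homothety q t^-1 @^-1` K°).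
  apply: open_comp; last exact: open_interior.
  by move=> z _; exact: (continuous_affine_homothety q t^-1).1.
have VK : homothety q t^-1 @^-1` K° `<=` homothety q t @` K.
  move=> z /= /interior_subset Kz; exists (homothety q t^-1 z) => //; exact: hK.
exists (homothety q t x); apply: (interiorS VK).
by rewrite (interior_id _).1// /preimage /= hK'.
Qed.

(** [D] never enlarges projections, so it maps a small homothetic copy of [K]
    about [q] to a subset of [D K] that meets the fibres close to the projection
    of [q]; a positive distance from the projection of [q] to that of [D K] is
    then impossible. *)
Lemma proj_sub_of_proj_contracting {R : realType} {n : nat} (H : {vspace 'rV[R]_n})
    (B : set (set 'rV[R]_n)) (D : set 'rV[R]_n -> set 'rV[R]_n) :
  B `<=` convex_compacts R n ->
  (forall K q t, 0 < t -> B K -> B (homothety q t @` K)) ->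
  (forall K, B K -> convex_compacts R n (D K)) ->
  monotonic B D ->
  (forall K, B K -> orth_proj H @` D K `<=` orth_proj H @` K) ->
  forall K, B K -> orth_proj H @` K `<=` orth_proj H @` D K.
Proof.
move=> BC Bh DC Dmono Dproj K BK _ [q Kq <-]; apply: contrapT => nDp.
pose p := orth_proj H q.
have aP x := continuous_affine_proj_sub H x.
have [D0 cD _] := DC _ BK.
have cp : {within D K, continuous (fun z => sqn (orth_proj H z - p))}.
  by apply/continuous_subspaceT/continuous_sqn; exact: (aP p).1.
have [z0 /set_mem Dz0 z0min] := compact_EVT_min D0 cD cp.
set d := sqn _ in z0min.
have d0 : 0 < d.
  apply: dotp_gt0; rewrite subr_eq0; apply: contra_notN nDp => /eqP z0p.
  by exists z0.
have [M M0 hM] := sqn_compact_bounded _ _ (aP p) (BC _ BK).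
(* The copy shrinks squared distances by [t ^+ 2 <= t], so [t * M < d] puts its
   projection strictly closer to [p] than any point of the projection of [D K]. *)
pose t := Num.min 1 (d / (2 * M)).
have t0 : 0 < t by rewrite lt_min ltr01 divr_gt0// mulr_gt0.
have t1 : t <= 1 by rewrite ge_min lexx.
have tM : t * M < d.
  have : t <= d / (2 * M) by rewrite ge_min lexx orbT.
  by rewrite ler_pdivlMr ?mulr_gt0//; lra.
have BK' := Bh K q t t0 BK.
have K'K : homothety q t @` K `<=` K.
  have [_ _ /convex_setP vK] := BC _ BK.
  by move=> _ [k Kk <-]; apply: vK => //; rewrite (ltW t0).
have [[z Dz] _ _] := DC _ BK'.
have [_ [k Kk <-] Pz] : (orth_proj H @` (homothety q t @` K)) (orth_proj H z).
  by apply: Dproj => //; exists z.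
have := z0min z (mem_set (Dmono _ _ BK' BK K'K _ Dz)).
have -> : orth_proj H z - p = t *: (orth_proj H k - p).
  rewrite -Pz linearD !linearZ /= -/p.
  by apply/rowP => j; rewrite !mxE; ring.
rewrite sqnZ => dle.
have := hM _ Kk; have := sqn_ge0 (orth_proj H k - p) => s0 sM.
have : t ^+ 2 * sqn (orth_proj H k - p) <= t * M.
  rewrite expr2 -mulrA ler_pM2l//.
  by apply: le_trans sM; rewrite ler_piMl.
by lra.
Qed.

Theorem theorem3p2 (R : realType) (n i : nat) (i_gt0 : (0 < i)%N) (i_ltn : (i < n)%N)
    (H : {vspace 'rV[R]_n}) (dimH : \dim H = i)
    (B : set (set 'rV[R]_n)) (hB : B = convex_compacts R n \/ B = convex_bodies R n)
    (D : {fun B >-> symmetric_members H B})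
    (hF : exists F : {fun B >-> [set a : R | 0 <= a]},
        strictly_increasing B F /\ preserving B D F)
    (hmono : monotonic B D) (hcyl : cylinder_invariant D H) :
  projection_invariant B D H.
Proof.
have bodyB K : convex_bodies R n K -> B K by case: hB => -> // -[].
have BC : B `<=` convex_compacts R n by case: hB => -> // K [].
have BD K : B K -> B (D K) by move=> /(@funS _ _ _ _ D)[].
have Bh K q t : 0 < t -> B K -> B (homothety q t @` K).
  move=> t0; case: hB => ->; last by apply: homothety_body; rewrite gt_eqF.
  by apply: convex_compacts_image; exact: continuous_affine_homothety.
have Dproj K : B K -> orth_proj H @` D K `<=` orth_proj H @` K.
  move=> BK; apply: proj_sub_of_cylinders; first exact: BC.
  move=> r s x r0 s0 xH KC; rewrite -(hcyl r s x)//.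
  by apply: hmono => //; apply: bodyB; exact: spherical_cylinder_body.
move=> K BK; apply/seteqP; split; first exact: Dproj.
apply: (@proj_sub_of_proj_contracting _ _ _ B) => // L BL.
exact/BC/BD.
Qed.
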